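(* If $n\ge0$, then $$a(2n)=\sum_{d=0}^{\lfloor\frac{n+1}{3}\rfloor}\binom{n+d+1}{4d}$$ and $$a(2n+1)=\sum_{d=0}^{\lfloor\frac{n}{3}\rfloor}\binom{n+d+2}{4d+2}.$$
   Context: The sequence $a(m)$, $m\ge0$, is defined by $a(0)=a(1)=a(2)=1$, $a(3)=3$ and the recurrence $a(m)=2a(m-2)+a(m-3)-a(m-4)$ for $m\ge4$. *)

(* Defs.v *)
From mathcomp Require Import all_boot all_order all_algebra.

Set Implicit Arguments.
Unset Strict Implicit.
Unset Printing Implicit Defensive.

Import GRing.Theory.
Local Open Scope ring_scope.

(* The values are taken in [int] because subtraction on [nat] is truncated. *)
Fixpoint a (m : nat) : int :=
  match m with
  | 0 | 1 | 2 => 1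
  | 3 => 3
  | ((m0.+1 as m1).+1 as m2).+2 => 2 * a m2 + a m1 - a m0
  end.

(* Main.v *)
Require Import Defs.
From mathcomp Require Import all_boot all_order all_algebra.
From mathcomp Require Import zify.

(** Both sums, extended to all [d], satisfy the recurrence termwise: in [n], the
    forward second difference of ['C(n + d + 1, 4 * d)] is ['C(n + d + 1, 4 * d - 2)],
    the summand of index [d - 1] in the odd sum, and that of
    ['C(n + d + 2, 4 * d + 2)] is ['C(n + d + 2, 4 * d)], the summand of index
    [d] in the even sum at [n + 1]. *)

Lemma bin_second_difference (x k : nat) :
  'C(x.+2, k.+2) + 'C(x, k.+2) = 2 * 'C(x.+1, k.+2) + 'C(x, k).
Proof. by rewrite !binS; lia. Qed.

Lemma sum_nat_truncate (F : nat -> nat) (m N : nat) :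
  m <= N -> (forall d, m <= d -> F d = 0) ->
  \sum_(0 <= d < N) F d = \sum_(0 <= d < m) F d.
Proof.
move=> le_mN F0; rewrite (big_cat_nat (n := m)) //=.
rewrite [X in _ + X]big_nat_cond [X in _ + X]big1 ?addn0 // => d.
by case/andP=> /andP[/F0].
Qed.

(** The cut-off [N] does not depend on [n], so sums at consecutive [n] share one range and compare
    term by term. *)
Definition even_sum (N n : nat) := \sum_(0 <= d < N) 'C(n + d + 1, 4 * d).
Definition odd_sum (N n : nat) := \sum_(0 <= d < N) 'C(n + d + 2, 4 * d + 2).

(** Once [3 * d > n + 1], the lower index [4 * d] exceeds [n + d + 1] and the binomial vanishes. *)
Lemma even_sum_truncate (N n : nat) :
  (n + 1) %/ 3 < N -> even_sum N n = even_sum ((n + 1) %/ 3).+1 n.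
Proof. by move=> ltN; apply: sum_nat_truncate => // d led; apply: bin_small; lia. Qed.

Lemma odd_sum_truncate (N n : nat) :
  n %/ 3 < N -> odd_sum N n = odd_sum (n %/ 3).+1 n.
Proof. by move=> ltN; apply: sum_nat_truncate => // d led; apply: bin_small; lia. Qed.

(** The terms [d = 0] of the even sums all equal 1 and cancel as 1 + 1 = 2; the others shift down by
    one, hence [N.+1] against [N]. *)
Lemma even_sum_rec (N n : nat) :
  even_sum N.+1 n.+2 + even_sum N.+1 n = 2 * even_sum N.+1 n.+1 + odd_sum N n.
Proof.
rewrite /even_sum /odd_sum !big_nat_recl // !muln0 !bin0.
suff: \sum_(0 <= d < N) 'C(n.+2 + d.+1 + 1, 4 * d.+1) +
      \sum_(0 <= d < N) 'C(n + d.+1 + 1, 4 * d.+1) =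
      2 * \sum_(0 <= d < N) 'C(n.+1 + d.+1 + 1, 4 * d.+1) +
      \sum_(0 <= d < N) 'C(n + d + 2, 4 * d + 2) by lia.
rewrite big_distrr -!big_split /=; apply: eq_bigr => d _.
have := bin_second_difference (n + d + 2) (4 * d + 2).
by congr ('C(_, _) + 'C(_, _) = 2 * 'C(_, _) + _); lia.
Qed.

Lemma odd_sum_rec (N n : nat) :
  odd_sum N n.+2 + odd_sum N n = 2 * odd_sum N n.+1 + even_sum N n.+1.
Proof.
rewrite /even_sum /odd_sum big_distrr -!big_split /=; apply: eq_bigr => d _.
have := bin_second_difference (n + d + 2) (4 * d).
by congr ('C(_, _) + 'C(_, _) = 2 * 'C(_, _) + 'C(_, _)); lia.
Qed.

Lemma a_rec (m : nat) : a m.+4 = (2 * a m.+2 + a m.+1 - a m)%R.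
Proof. by []. Qed.

Lemma a_eq_sums (N n : nat) : n < N ->
  a (2 * n) = Posz (even_sum N.+1 n) /\ a (2 * n + 1) = Posz (odd_sum N n).
Proof.
elim/ltn_ind: n => -[|[|n]] IH ltN.
(* For [n] equal to 0 or 1, only the terms [d = 0] remain. *)
- rewrite even_sum_truncate // odd_sum_truncate //.
  by rewrite /even_sum /odd_sum !big_nat1.
- rewrite even_sum_truncate // odd_sum_truncate; last by lia.
  by rewrite /even_sum /odd_sum !big_nat1.
have [||e0 o0] := IH n; [lia..|].
have [||e1 o1] := IH n.+1; [lia..|].
(* [odd_sum_rec] involves the even sum cut at [N], the induction hypothesis the one cut at [N.+1];
   the extra term [d = N] is zero. *)
have eN : even_sum N.+1 n.+1 = even_sum N n.+1.
  by rewrite even_sum_truncate ?[RHS]even_sum_truncate //; lia.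
have -> : 2 * n.+2 + 1 = (2 * n).+1.+4 by lia.
have -> : 2 * n.+2 = (2 * n).+4 by lia.
move: o0 e1 o1; rewrite addn1.
have -> : 2 * n.+1 + 1 = (2 * n).+3 by lia.
have -> : 2 * n.+1 = (2 * n).+2 by lia.
move=> o0 e1 o1; rewrite !a_rec e0 o0 e1 o1.
have := even_sum_rec N n; have := odd_sum_rec N n.
by split; lia.
Qed.

Theorem corollary8 (n : nat) :
  a (2 * n) = Posz (\sum_(0 <= d < ((n + 1) %/ 3).+1) 'C(n + d + 1, 4 * d)) /\
  a (2 * n + 1) = Posz (\sum_(0 <= d < (n %/ 3).+1) 'C(n + d + 2, 4 * d + 2)).
Proof.
have [-> ->] := a_eq_sums n.+1 n (ltnSn n).
by rewrite even_sum_truncate ?odd_sum_truncate //; lia.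
Qed.
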